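(* (1) A cofibrant approximation $t:\mathcal M'\to\mathcal M$ of a precofibration category $\mathcal M$ induces an equivalence of categories $\mathbf{ho}\mathcal M'\to\mathbf{ho}\mathcal M$. (2) A fibrant approximation $t:\mathcal M'\to\mathcal M$ of a prefibration category $\mathcal M$ induces an equivalence of categories $\mathbf{ho}\mathcal M'\to\mathbf{ho}\mathcal M$.
   Context: A precofibration category $(\mathcal M,\mathcal W,\mathrm{Cof})$ is a category $\mathcal M$ with two classes of maps, weak equivalences $\mathcal W$ and cofibrations $\mathrm{Cof}$ (a trivial cofibration is a map in both; $A$ is cofibrant if $\mathbf 0\to A$ is a cofibration, $\mathbf 0$ the initial object), such that: CF1: $\mathcal M$ has an initial object $\mathbf 0$, which is cofibrant; cofibrations are stable under composition; all isomorphisms are weak equivalences, and all isomorphisms with cofibrant domain are trivial cofibrations. CF2: if $gf$ is defined and two of $f,g,gf$ are weak equivalences, so is the third. CF3: for a cofibration $i:A\to B$ and a map $A\to C$ with $A,C$ cofibrant, (1) the pushout of $i$ along $A\to C$ exists and $C\to B\sqcup_A C$ is a cofibration; (2) if $i$ is a trivial cofibration, so is $C\to B\sqcup_A C$. CF4: any map $f:A\to B$ with $A$ cofibrant factors as $f=rf'$ with $f'$ a cofibration and $r$ a weak equivalence. $(\mathcal M,\mathcal W,\mathrm{Fib})$ is a prefibration category if $(\mathcal M^{op},\mathcal W^{op},\mathrm{Fib}^{op})$ is a precofibration category. $\mathbf{ho}\mathcal M=\mathcal M[\mathcal W^{-1}]$ is the localization at the weak equivalences. For a precofibration category $\mathcal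 M$, a functor $t:\mathcal M'\to\mathcal M$ is a cofibrant approximation if $\mathcal M'$ is a precofibration category with all objects cofibrant and: CFA1: $t$ preserves the initial object and cofibrations; CFA2: a map $f$ of $\mathcal M'$ is a weak equivalence iff $tf$ is; CFA3: if $A\to B$, $A\to C$ are cofibrations of $\mathcal M'$, the natural map $tB\sqcup_{tA}tC\to t(B\sqcup_AC)$ is an isomorphism; CFA4: any map $f:tA\to B$ factors as $f=r\circ tf'$ with $f'$ a cofibration of $\mathcal M'$ and $r$ a weak equivalence of $\mathcal M$. For a prefibration category $\mathcal M$, $t:\mathcal M'\to\mathcal M$ is a fibrant approximation if $t^{op}:\mathcal M'^{op}\to\mathcal M^{op}$ is a cofibrant approximation. *)

(* Defs.v *)
From Stdlib Require Import ClassicalEpsilon FunctionalExtensionality.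
From Stdlib Require Import PropExtensionality ProofIrrelevance.

Set Implicit Arguments.
Unset Strict Implicit.

Declare Scope cat_scope.
Delimit Scope cat_scope with cat.
Local Open Scope cat_scope.

Record category := Category {
  Ob :> Type;
  Hom : Ob -> Ob -> Type;
  idm : forall A, Hom A A;
  comp : forall A B C, Hom B C -> Hom A B -> Hom A C;
  comp_idl : forall A B (f : Hom A B), comp (idm B) f = f;
  comp_idr : forall A B (f : Hom A B), comp f (idm A) = f;
  comp_assoc : forall A B C D (h : Hom C D) (g : Hom B C) (f : Hom A B),
    comp h (comp g f) = comp (comp h g) f
}.

Arguments Hom {c} A B.
Arguments idm {c} A.
Arguments comp {c A B C} g f.

Notation "g ∘ f" := (comp g f) (at level 40, left associativity) : cat_scope.

Record functor (C D : category) := Functor {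
  fob :> C -> D;
  fmap : forall A B, Hom A B -> Hom (fob A) (fob B);
  fmap_id : forall A, fmap (idm A) = idm (fob A);
  fmap_comp : forall A B E (g : Hom B E) (f : Hom A B),
    fmap (g ∘ f) = fmap g ∘ fmap f
}.

Arguments fmap {C D} F {A B} f : rename.

Lemma functor_eq_map (C D : category) (o : C -> D)
    (m1 m2 : forall A B, Hom A B -> Hom (o A) (o B)) i1 i2 c1 c2 :
  m1 = m2 -> @Functor C D o m1 i1 c1 = @Functor C D o m2 i2 c2.
Proof. intro e; subst m2; f_equal; apply proof_irrelevance. Qed.

Lemma functor_eta (C D : category) (F : functor C D) :
  @Functor C D (fob F) (@fmap C D F) (@fmap_id C D F) (@fmap_comp C D F) = F.
Proof. now destruct F. Qed.

Definition id_functor (C : category) : functor C C :=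
  @Functor C C (fun A => A) (fun _ _ f => f)
    (fun _ => eq_refl) (fun _ _ _ _ _ => eq_refl).

Program Definition comp_functor (C D E : category)
    (G : functor D E) (F : functor C D) : functor C E :=
  @Functor C E (fun A => G (F A)) (fun _ _ f => fmap G (fmap F f)) _ _.
Next Obligation. now rewrite !fmap_id. Qed.
Next Obligation. now rewrite !fmap_comp. Qed.

Definition op (C : category) : category :=
  @Category C (fun A B => @Hom C B A) (fun A => idm A)
    (fun _ _ _ g f => f ∘ g)
    (fun _ _ f => comp_idr f) (fun _ _ f => comp_idl f)
    (fun _ _ _ _ h g f => eq_sym (comp_assoc f g h)).

Definition op_functor (C D : category) (F : functor C D) :
    functor (op C) (op D) :=
  @Functor (op C) (op D) F (fun A B f => @fmap C D F B A f)
    (fun A => fmap_id F A) (fun _ _ _ g f => fmap_comp F f g).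

Definition is_iso (C : category) (A B : C) (f : Hom A B) : Prop :=
  exists g : Hom B A, g ∘ f = idm A /\ f ∘ g = idm B.

Lemma inverse_unique (C : category) (A B : C) (f : Hom A B) (g g' : Hom B A) :
  g ∘ f = idm A -> f ∘ g' = idm B -> g = g'.
Proof.
intros e e'; now rewrite <- (comp_idr g), <- e', comp_assoc, e, comp_idl.
Qed.

Definition is_initial (C : category) (I : C) : Prop :=
  forall A : C, exists! f : Hom I A, True.

Definition is_pushout (M : category) (A B C P : M) (i : Hom A B) (f : Hom A C)
    (inB : Hom B P) (inC : Hom C P) : Prop :=
  inB ∘ i = inC ∘ f /\
  forall (X : M) (u : Hom B X) (v : Hom C X), u ∘ i = v ∘ f ->
    exists! h : Hom P X, h ∘ inB = u /\ h ∘ inC = v.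

Definition nat_isomorphic (C D : category) (F G : functor C D) : Prop :=
  exists eta : forall A : C, Hom (F A) (G A),
    (forall A, is_iso (eta A)) /\
    (forall (A B : C) (f : Hom A B), eta B ∘ fmap F f = fmap G f ∘ eta A).

Definition is_equivalence (C D : category) (F : functor C D) : Prop :=
  exists G : functor D C,
    nat_isomorphic (comp_functor G F) (id_functor C) /\
    nat_isomorphic (comp_functor F G) (id_functor D).

Definition mor_class (C : category) : Type :=
  forall A B : C, Hom A B -> Prop.

Definition op_class (C : category) (W : mor_class C) : mor_class (op C) :=
  fun A B f => W B A f.

Definition preserves (C D : category) (W : mor_class C) (V : mor_class D)
    (F : functor C D) : Prop :=
  forall (A B : C) (f : Hom A B), W A B f -> V (F A) (F B) (fmap F f).

Definition inverts (C D : category) (W : mor_class C) (F : functor C D) : Prop :=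
  forall (A B : C) (f : Hom A B), W A B f -> is_iso (fmap F f).

(** [ho W] is the category presented by the maps of [M] together with a formal
    inverse of each map of [W]; it has the objects of [M], and its maps are
    formal composites modulo the congruence [loc_eq].  By [gamma_inverts],
    [ho_lift_gamma] and [ho_lift_unique], [gamma : M -> ho W] is the strict
    universal functor inverting [W]. *)

Section Localization.

Variables (M : category) (W : mor_class M).

Inductive loc_term : M -> M -> Type :=
| loc_map A B : Hom A B -> loc_term A B
| loc_inv A B (w : Hom A B) : W w -> loc_term B A
| loc_comp A B C : loc_term B C -> loc_term A B -> loc_term A C.

Inductive loc_eq : forall A B, loc_term A B -> loc_term A B -> Prop :=
| loc_refl A B (p : loc_term A B) : loc_eq p p
| loc_sym A B (p q : loc_term A B) : loc_eq p q -> loc_eq q p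
| loc_trans A B (p q r : loc_term A B) :
    loc_eq p q -> loc_eq q r -> loc_eq p r
| loc_congr A B C (p p' : loc_term B C) (q q' : loc_term A B) :
    loc_eq p p' -> loc_eq q q' -> loc_eq (loc_comp p q) (loc_comp p' q')
| loc_assoc A B C D (p : loc_term C D) (q : loc_term B C) (r : loc_term A B) :
    loc_eq (loc_comp p (loc_comp q r)) (loc_comp (loc_comp p q) r)
| loc_idl A B (p : loc_term A B) : loc_eq (loc_comp (loc_map (idm B)) p) p
| loc_idr A B (p : loc_term A B) : loc_eq (loc_comp p (loc_map (idm A))) p
| loc_mapM A B C (g : Hom B C) (f : Hom A B) :
    loc_eq (loc_map (g ∘ f)) (loc_comp (loc_map g) (loc_map f))
| loc_invl A B (w : Hom A B) (hw : W w) :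
    loc_eq (loc_comp (loc_inv hw) (loc_map w)) (loc_map (idm A))
| loc_invr A B (w : Hom A B) (hw : W w) :
    loc_eq (loc_comp (loc_map w) (loc_inv hw)) (loc_map (idm B)).

(** Maps of the localization are equivalence classes, as predicates. *)
Definition ho_hom (A B : M) : Type :=
  {P : loc_term A B -> Prop | exists p, P = loc_eq p}.

Definition ho_class (A B : M) (p : loc_term A B) : ho_hom A B :=
  exist _ (loc_eq p) (ex_intro _ p eq_refl).

Definition ho_repr (A B : M) (c : ho_hom A B) : loc_term A B :=
  proj1_sig (constructive_indefinite_description _ (proj2_sig c)).

Lemma ho_reprK (A B : M) (c : ho_hom A B) : ho_class (ho_repr c) = c.
Proof.
destruct c as [P hP]; unfold ho_repr; simpl.
destruct (constructive_indefinite_description _ hP) as [p e]; simpl.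
subst P; unfold ho_class; f_equal; apply proof_irrelevance.
Qed.

Lemma ho_classP (A B : M) (p q : loc_term A B) :
  ho_class p = ho_class q <-> loc_eq p q.
Proof.
split; intro h.
- apply (f_equal (fun c => proj1_sig c q)) in h; simpl in h.
  rewrite h; apply loc_refl.
- assert (e : loc_eq p = loc_eq q).
  { apply functional_extensionality; intro r; apply propositional_extensionality.
    split; intro k.
    - exact (loc_trans (loc_sym h) k).
    - exact (loc_trans h k). }
  unfold ho_class; generalize (ex_intro (fun x => loc_eq p = loc_eq x) p eq_refl).
  rewrite e; intro k; f_equal; apply proof_irrelevance.
Qed.

Lemma ho_class_repr (A B : M) (p : loc_term A B) : loc_eq (ho_repr (ho_class p)) p.
Proof. apply ho_classP; apply ho_reprK. Qed.

Definition ho_comp (A B C : M) (c : ho_hom B C) (d : ho_hom A B) : ho_hom A C :=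
  ho_class (loc_comp (ho_repr c) (ho_repr d)).

Lemma ho_comp_class (A B C : M) (p : loc_term B C) (q : loc_term A B) :
  ho_comp (ho_class p) (ho_class q) = ho_class (loc_comp p q).
Proof. apply ho_classP; apply loc_congr; apply ho_class_repr. Qed.

Program Definition ho : category :=
  @Category M ho_hom (fun A => ho_class (loc_map (idm A))) ho_comp _ _ _.
Next Obligation.
rewrite <- (ho_reprK f), ho_comp_class; apply ho_classP, loc_idl.
Qed.
Next Obligation.
rewrite <- (ho_reprK f), ho_comp_class; apply ho_classP, loc_idr.
Qed.
Next Obligation.
rewrite <- (ho_reprK f), <- (ho_reprK g), <- (ho_reprK h), !ho_comp_class.
apply ho_classP, loc_assoc.
Qed.

Program Definition gamma : functor M ho :=
  @Functor M ho (fun A => A) (fun A B f => ho_class (loc_map f)) _ _.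
Next Obligation.
change (ho_class (loc_map (g ∘ f)) =
  ho_comp (ho_class (loc_map g)) (ho_class (loc_map f))).
rewrite ho_comp_class; apply ho_classP, loc_mapM.
Qed.

Lemma gamma_inverts : inverts W gamma.
Proof.
intros A B w hw; exists (ho_class (loc_inv hw)); split.
- change (ho_comp (ho_class (loc_inv hw)) (ho_class (loc_map w)) =
    ho_class (loc_map (idm A))).
  rewrite ho_comp_class; apply ho_classP, loc_invl.
- change (ho_comp (ho_class (loc_map w)) (ho_class (loc_inv hw)) =
    ho_class (loc_map (idm B))).
  rewrite ho_comp_class; apply ho_classP, loc_invr.
Qed.

Section Lift.

Variables (D : category) (F : functor M D) (hF : inverts W F).

Fixpoint loc_eval (A B : M) (p : loc_term A B) : Hom (F A) (F B) :=
  match p in loc_term A B return Hom (F A) (F B) with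
  | loc_map f => fmap F f
  | loc_inv hw => proj1_sig (constructive_indefinite_description _ (hF hw))
  | loc_comp p q => loc_eval p ∘ loc_eval q
  end.

Lemma loc_eval_eq (A B : M) (p q : loc_term A B) :
  loc_eq p q -> loc_eval p = loc_eval q.
Proof.
induction 1; simpl; try congruence.
- apply comp_assoc.
- rewrite fmap_id; apply comp_idl.
- rewrite fmap_id; apply comp_idr.
- apply fmap_comp.
- destruct (constructive_indefinite_description _ _) as [v [e1 e2]]; simpl.
  now rewrite fmap_id.
- destruct (constructive_indefinite_description _ _) as [v [e1 e2]]; simpl.
  now rewrite fmap_id.
Qed.

Program Definition ho_lift : functor ho D :=
  @Functor ho D F (fun A B c => loc_eval (ho_repr c)) _ _.
Next Obligation.
rewrite (loc_eval_eq (ho_class_repr _)); simpl; apply fmap_id.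
Qed.
Next Obligation.
exact (loc_eval_eq (ho_class_repr _)).
Qed.

Lemma ho_lift_gamma_map (A B : M) (f : Hom A B) :
  fmap ho_lift (fmap gamma f) = fmap F f.
Proof. exact (loc_eval_eq (ho_class_repr (loc_map f))). Qed.

Lemma ho_lift_gamma : comp_functor ho_lift gamma = F.
Proof.
assert (e : (fun A B f => fmap ho_lift (fmap gamma f)) = @fmap M D F).
{ apply functional_extensionality_dep; intro A.
  apply functional_extensionality_dep; intro B.
  apply functional_extensionality; intro f; apply ho_lift_gamma_map. }
exact (eq_trans
  (functor_eq_map _ (@fmap_id M D F) _ (@fmap_comp M D F) e) (functor_eta F)).
Qed.

End Lift.

Lemma ho_lift_unique (D : category) (G1 G2 : functor ho D) :
  comp_functor G1 gamma = comp_functor G2 gamma -> G1 = G2.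
Proof.
destruct G1 as [o1 m1 i1 c1], G2 as [o2 m2 i2 c2]; intro e.
assert (eo : o1 = o2) by exact (f_equal (@fob _ _) e).
subst o2.
pose (T := fun o : M -> D => forall A B : M, Hom A B -> Hom (o A) (o B)).
assert (em : (fun A B f => m1 A B (fmap gamma f)) =
             (fun A B f => m2 A B (fmap gamma f)) :> T o1).
{ apply (inj_pair2 _ T).
  exact (f_equal (fun H : functor M D => existT T (fob H) (@fmap M D H)) e). }
apply functor_eq_map.
apply functional_extensionality_dep; intro A.
apply functional_extensionality_dep; intro B.
apply functional_extensionality; intro c.
rewrite <- (ho_reprK c); generalize (ho_repr c); clear c e; intro p.
induction p as [A B f|A B w hw|A B C p IHp q IHq].
- exact (f_equal (fun m : T o1 => m A B f) em).
- assert (ew : m1 A B (fmap gamma w) = m2 A B (fmap gamma w))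
    by exact (f_equal (fun m : T o1 => m A B w) em).
  assert (el : comp (c := ho) (ho_class (loc_inv hw)) (fmap gamma w) = idm (c := ho) A).
  { exact (eq_trans (ho_comp_class _ _) (proj2 (ho_classP _ _) (loc_invl hw))). }
  assert (er : comp (c := ho) (fmap gamma w) (ho_class (loc_inv hw)) = idm (c := ho) B).
  { exact (eq_trans (ho_comp_class _ _) (proj2 (ho_classP _ _) (loc_invr hw))). }
  pose proof (eq_trans (eq_sym (c1 _ _ _ _ _)) (eq_trans (f_equal (m1 A A) el) (i1 A))) as l1.
  pose proof (eq_trans (eq_sym (c2 _ _ _ _ _)) (eq_trans (f_equal (m2 B B) er) (i2 B))) as r2.
  exact (inverse_unique l1 (eq_trans (f_equal (fun f => comp f _) ew) r2)).
- rewrite <- ho_comp_class.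
  refine (eq_trans (c1 _ _ _ _ _) (eq_trans _ (eq_sym (c2 _ _ _ _ _)))).
  now rewrite IHp, IHq.
Qed.

End Localization.

Lemma gamma_comp_inverts (M' M : category) (W' : mor_class M')
    (W : mor_class M) (t : functor M' M) :
  preserves W' W t -> inverts W' (comp_functor (gamma W) t).
Proof. intros h A B f hf; exact (gamma_inverts (h _ _ _ hf)). Qed.

(** The unique [T] such that [T ∘ gamma W' = gamma W ∘ t]. *)
Definition ho_functor (M' M : category) (W' : mor_class M') (W : mor_class M)
    (t : functor M' M) (ht : preserves W' W t) : functor (ho W') (ho W) :=
  ho_lift (gamma_comp_inverts ht).

Lemma ho_functor_gamma (M' M : category) (W' : mor_class M')
    (W : mor_class M) (t : functor M' M) (ht : preserves W' W t) :
  comp_functor (ho_functor ht) (gamma W') = comp_functor (gamma W) t.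
Proof. apply ho_lift_gamma. Qed.

Definition cofibrant (M : category) (Cof : mor_class M) (zero A : M) : Prop :=
  exists i : Hom zero A, Cof zero A i.

(** In [cof_pushout] and [trivial_cof_pushout] every choice of pushout is
    allowed; by [iso_cof] and [cof_comp] this amounts to one choice. *)
Record precofibration (M : category) (W Cof : mor_class M) := Precofibration {
  zero : M;
  zero_initial : is_initial zero;
  zero_cofibrant : cofibrant Cof zero zero;
  cof_comp : forall (A B C : M) (g : Hom B C) (f : Hom A B),
    Cof A B f -> Cof B C g -> Cof A C (g ∘ f);
  iso_weq : forall (A B : M) (f : Hom A B), is_iso f -> W A B f;
  iso_cof : forall (A B : M) (f : Hom A B),
    cofibrant Cof zero A -> is_iso f -> W A B f /\ Cof A B f;
  weq_comp : forall (A B C : M) (g : Hom B C) (f : Hom A B),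
    W A B f -> W B C g -> W A C (g ∘ f);
  weq_cancel_right : forall (A B C : M) (g : Hom B C) (f : Hom A B),
    W A B f -> W A C (g ∘ f) -> W B C g;
  weq_cancel_left : forall (A B C : M) (g : Hom B C) (f : Hom A B),
    W B C g -> W A C (g ∘ f) -> W A B f;
  cof_pushout_exists : forall (A B C : M) (i : Hom A B) (f : Hom A C),
    cofibrant Cof zero A -> cofibrant Cof zero C -> Cof A B i ->
    exists (P : M) (inB : Hom B P) (inC : Hom C P), is_pushout i f inB inC;
  cof_pushout : forall (A B C P : M) (i : Hom A B) (f : Hom A C)
      (inB : Hom B P) (inC : Hom C P),
    cofibrant Cof zero A -> cofibrant Cof zero C -> Cof A B i ->
    is_pushout i f inB inC -> Cof C P inC;
  trivial_cof_pushout : forall (A B C P : M) (i : Hom A B) (f : Hom A C)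
      (inB : Hom B P) (inC : Hom C P),
    cofibrant Cof zero A -> cofibrant Cof zero C -> Cof A B i -> W A B i ->
    is_pushout i f inB inC -> Cof C P inC /\ W C P inC;
  cof_weq_factor : forall (A B : M) (f : Hom A B), cofibrant Cof zero A ->
    exists (X : M) (f' : Hom A X) (r : Hom X B),
      Cof A X f' /\ W X B r /\ f = r ∘ f'
}.

Definition prefibration (M : category) (W Fib : mor_class M) :=
  precofibration (op_class W) (op_class Fib).

Record cofibrant_approximation (M' M : category) (W' Cof' : mor_class M')
    (W Cof : mor_class M) (S' : precofibration W' Cof')
    (S : precofibration W Cof) (t : functor M' M) : Prop :=
  CofibrantApproximation {
  approx_all_cofibrant : forall A : M', cofibrant Cof' (zero S') A;
  approx_initial : is_initial (t (zero S'));
  approx_cof : preserves Cof' Cof t;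
  approx_weq : forall (A B : M') (f : Hom A B),
    W' A B f <-> W (t A) (t B) (fmap t f);
  (** [h] is the natural map [tB ⊔_tA tC -> t (B ⊔_A C)]. *)
  approx_pushout : forall (A B C P : M') (i : Hom A B) (f : Hom A C)
      (inB : Hom B P) (inC : Hom C P)
      (Q : M) (jB : Hom (t B) Q) (jC : Hom (t C) Q) (h : Hom Q (t P)),
    Cof' A B i -> Cof' A C f -> is_pushout i f inB inC ->
    is_pushout (fmap t i) (fmap t f) jB jC ->
    h ∘ jB = fmap t inB -> h ∘ jC = fmap t inC -> is_iso h;
  approx_factor : forall (A : M') (B : M) (f : Hom (t A) B),
    exists (X : M') (f' : Hom A X) (r : Hom (t X) B),
      Cof' A X f' /\ W (t X) B r /\ f = r ∘ fmap t f'
}.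

Definition fibrant_approximation (M' M : category) (W' Fib' : mor_class M')
    (W Fib : mor_class M) (S' : prefibration W' Fib')
    (S : prefibration W Fib) (t : functor M' M) : Prop :=
  @cofibrant_approximation (op M') (op M) _ _ _ _ S' S (op_functor t).

Lemma cofibrant_approximation_weq (M' M : category) (W' Cof' : mor_class M')
    (W Cof : mor_class M) (S' : precofibration W' Cof')
    (S : precofibration W Cof) (t : functor M' M) :
  cofibrant_approximation S' S t -> preserves W' W t.
Proof. intros h A B f; exact (proj1 (approx_weq h f)). Qed.

Lemma fibrant_approximation_weq (M' M : category) (W' Fib' : mor_class M')
    (W Fib : mor_class M) (S' : prefibration W' Fib')
    (S : prefibration W Fib) (t : functor M' M) :
  fibrant_approximation S' S t -> preserves W' W t.
Proof. intros h A B f; exact (proj1 (@approx_weq _ _ _ _ _ _ _ _ _ h B A f)). Qed.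

(* Main.v *)
(** Every object [B] of [M] receives a weak equivalence [r_B : t X_B -> B].  Given
    [a : t X -> C] and a weak equivalence [s : t Z -> C], there is a cospan
    [u : X -> Y <- Z : w] in [M'] over [C], with [w] a weak equivalence, and the
    fraction [w^-1 u : X -> Z] in [ho M'] depends only on [a] and [s]: two cospans
    are compared by gluing them along [X ⊔ Z] and factoring the resulting map to
    [C].  These fractions compose, so [f : B -> C] going to the fraction of
    [f r_B] by [r_C] is a functor [M -> ho M'] inverting weak equivalences; the
    functor it induces on [ho M] is quasi-inverse to [ho t].  The fibrant case
    follows because [ho] commutes with passing to opposite categories. *)

From Stdlib Require Import ClassicalEpsilon.
Require Import Defs.

Set Implicit Arguments.
Unset Strict Implicit.
Local Open Scope cat_scope.

(** * Categories and localizations *)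

Lemma fmap_iso (C D : category) (F : functor C D) (A B : C) (f : Hom A B) :
  is_iso f -> is_iso (fmap F f).
Proof.
intros [g [e1 e2]]; exists (fmap F g).
now rewrite <- !fmap_comp, e1, e2, !fmap_id.
Qed.

Lemma iso_monic (C : category) (A B X : C) (f : Hom A B) (g h : Hom X A) :
  is_iso f -> f ∘ g = f ∘ h -> g = h.
Proof.
intros [k [e _]] E.
now rewrite <- (comp_idl g), <- (comp_idl h), <- e, <- !comp_assoc, E.
Qed.

Lemma iso_cancel_left (C : category) (A B X : C) (f : Hom A B) (g : Hom X A) :
  is_iso f -> is_iso (f ∘ g) -> is_iso g.
Proof.
intros hf [k [e1 e2]]; exists (k ∘ f); split.
- now rewrite <- comp_assoc.
- apply (iso_monic hf); now rewrite !comp_assoc, e2, comp_idl, comp_idr.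
Qed.

Lemma iso_id (C : category) (A : C) : is_iso (idm A).
Proof. exists (idm A); split; apply comp_idl. Qed.

Lemma is_iso_op (C : category) (A B : C) (f : Hom A B) :
  is_iso f -> @is_iso (op C) B A f.
Proof. intros [g [e1 e2]]; now exists g. Qed.

Lemma nat_isomorphic_sym (C D : category) (F G : functor C D) :
  nat_isomorphic F G -> nat_isomorphic G F.
Proof.
intros [eta [hiso hnat]].
pose (inv := fun A => constructive_indefinite_description _ (hiso A)).
exists (fun A => proj1_sig (inv A)); split.
- intro A; destruct (proj2_sig (inv A)) as [e1 e2]; now exists (eta A).
- intros A B f; apply (iso_monic (hiso B)).
  destruct (proj2_sig (inv A)) as [_ eA], (proj2_sig (inv B)) as [_ eB].
  now rewrite !comp_assoc, eB, hnat, <- comp_assoc, eA, comp_idl, comp_idr.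
Qed.

Lemma initial_eq (C : category) (I A : C) (f g : Hom I A) :
  is_initial I -> f = g.
Proof.
intro h; destruct (h A) as [k [_ hk]].
now rewrite <- (hk f Logic.I), <- (hk g Logic.I).
Qed.

Lemma initial_iso (C : category) (I J : C) (f : Hom I J) :
  is_initial I -> is_initial J -> is_iso f.
Proof.
intros hI hJ; destruct (hJ I) as [g _]; exists g.
split; now apply initial_eq.
Qed.

Lemma pushout_sym (C : category) (A B D P : C) (i : Hom A B) (f : Hom A D)
    (inB : Hom B P) (inD : Hom D P) :
  is_pushout i f inB inD -> is_pushout f i inD inB.
Proof.
intros [e h]; split; [easy|].
intros X u v E; destruct (h X v u (eq_sym E)) as [k [[k1 k2] uk]].
exists k; split; [easy|]; intros k' [? ?]; now apply uk.
Qed.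

Lemma pushout_epic (C : category) (A B D P X : C) (i : Hom A B) (f : Hom A D)
    (inB : Hom B P) (inD : Hom D P) (h k : Hom P X) :
  is_pushout i f inB inD -> h ∘ inB = k ∘ inB -> h ∘ inD = k ∘ inD -> h = k.
Proof.
intros [e p] e1 e2.
destruct (p X (k ∘ inB) (k ∘ inD)) as [l [_ ul]].
- now rewrite <- !comp_assoc, e.
- transitivity l; [symmetry|]; now apply ul.
Qed.

Lemma pushout_iso (C : category) (A B D P Q : C) (i : Hom A B) (f : Hom A D)
    (inB : Hom B P) (inD : Hom D P) (h : Hom P Q) :
  is_pushout i f inB inD -> is_iso h -> is_pushout i f (h ∘ inB) (h ∘ inD).
Proof.
intros po [k [e1 e2]]; split.
- now rewrite <- !comp_assoc, (proj1 po).
- intros X u v E; destruct (proj2 po X u v E) as [l [[l1 l2] ul]].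
  assert (K : forall Y (g : Hom Y P), k ∘ (h ∘ g) = g).
  { intros Y g; now rewrite comp_assoc, e1, comp_idl. }
  exists (l ∘ k); split.
  + now rewrite <- !comp_assoc, !K.
  + intros l' [m1 m2]; rewrite (ul (l' ∘ h)).
    * now rewrite <- comp_assoc, e2, comp_idr.
    * now rewrite <- !comp_assoc.
Qed.

Section Ho.

Variables (M : category) (W : mor_class M).

(** [fmap (gamma W) f] with its endpoints typed as objects of [M], which
    keeps rewriting from having to unfold [gamma]. *)
Definition gmap (A B : M) (f : Hom A B) : @Hom (ho W) A B := fmap (gamma W) f.

Lemma gmap_comp (A B C : M) (g : Hom B C) (f : Hom A B) :
  gmap (g ∘ f) = gmap g ∘ gmap f.
Proof. exact (fmap_comp (gamma W) g f). Qed.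

Lemma gmap_iso (A B : M) (f : Hom A B) : W f -> is_iso (gmap f).
Proof. exact (@gamma_inverts M W A B f). Qed.

Lemma gmap_monic (A B X : M) (f : Hom A B) (g h : @Hom (ho W) X A) :
  W f -> gmap f ∘ g = gmap f ∘ h -> g = h.
Proof. intro hf; exact (iso_monic (gmap_iso hf)). Qed.

Lemma gmap_lift (D : category) (F : functor M D) (hF : inverts W F)
    (A B : M) (f : Hom A B) :
  fmap (ho_lift hF) (gmap f) = fmap F f.
Proof. exact (ho_lift_gamma_map hF f). Qed.

(** Induction on a representing term. The inverse case receives [v] only through its two equations,
    so later proofs never meet [loc_term]. *)
Lemma ho_ind (P : forall A B : M, @Hom (ho W) A B -> Prop) :
  (forall (A B : M) (f : Hom A B), P A B (gmap f)) ->
  (forall (A B : M) (w : Hom A B) (v : @Hom (ho W) B A), W w ->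
    v ∘ gmap w = idm (c := ho W) A ->
    gmap w ∘ v = idm (c := ho W) B -> P B A v) ->
  (forall (A B C : M) (g : @Hom (ho W) B C) (f : @Hom (ho W) A B),
    P B C g -> P A B f -> P A C (g ∘ f)) ->
  forall (A B : M) (c : @Hom (ho W) A B), P A B c.
Proof.
intros h1 h2 h3 A B c.
rewrite <- (ho_reprK c); generalize (ho_repr c); clear c; intro p.
induction p as [A B f|A B w hw|A B C p IHp q IHq].
- apply h1.
- apply (h2 A B w); [exact hw| |].
  + exact (eq_trans (ho_comp_class _ _) (proj2 (ho_classP _ _) (loc_invl hw))).
  + exact (eq_trans (ho_comp_class _ _) (proj2 (ho_classP _ _) (loc_invr hw))).
- rewrite <- ho_comp_class; exact (h3 _ _ _ _ _ IHp IHq).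
Qed.

(** Naturality squares compose, and the square of an inverse [v] follows from that of [w] by
    composing with [v] on both sides. Only maps of [M] remain to be checked. *)
Lemma ho_natural (D : category) (F G : functor (ho W) D)
    (eta : forall A : ho W, Hom (F A) (G A)) :
  (forall (A B : M) (f : Hom A B),
    eta B ∘ fmap F (gmap f) = fmap G (gmap f) ∘ eta A) ->
  forall (A B : ho W) (c : Hom A B), eta B ∘ fmap F c = fmap G c ∘ eta A.
Proof.
intros h A B c; revert A B c.
refine (@ho_ind (fun A B c => eta B ∘ fmap F c = fmap G c ∘ eta A) h _ _).
- intros A B w v hw e1 e2.
  rewrite <- (comp_idl (eta A)), <- (fmap_id G), <- e1, (fmap_comp G v).
  rewrite <- (comp_assoc _ _ (eta A)), <- h, <- !comp_assoc, <- fmap_comp, e2.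
  now rewrite fmap_id, comp_idr.
- intros A B C g f eg ef.
  now rewrite !fmap_comp, comp_assoc, eg, <- comp_assoc, ef, comp_assoc.
Qed.

End Ho.

(** * Fractions *)

Section Approximation.

Variables (M' M : category) (W' Cof' : mor_class M') (W Cof : mor_class M).
Variables (S' : precofibration W' Cof') (S : precofibration W Cof).
Variables (t : functor M' M) (ht : cofibrant_approximation S' S t).

Let all_cof := approx_all_cofibrant ht.

(** The map from [zero S] to [t (zero S')] joins two initial objects, so it is an isomorphism with
    cofibrant domain, hence a cofibration; [t] of a cofibration follows it. *)
Lemma approx_cofibrant (A : M') : cofibrant Cof (zero S) (t A).
Proof.
destruct (all_cof A) as [i hi].
destruct (zero_initial S (t (zero S'))) as [j _].
exists (fmap t i ∘ j); apply (cof_comp S).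
- apply (iso_cof (p := S)).
  + apply zero_cofibrant.
  + apply initial_iso; [apply zero_initial|exact (approx_initial ht)].
- exact (approx_cof ht hi).
Qed.

(** [M] has a pushout [Q] of the image span, since its objects are cofibrant; [approx_pushout] makes
    the comparison [Q -> t P] an isomorphism, which carries the universal property over. *)
Lemma approx_preserves_pushout (A B C P : M') (i : Hom A B) (f : Hom A C)
    (inB : Hom B P) (inC : Hom C P) :
  Cof' i -> Cof' f -> is_pushout i f inB inC ->
  is_pushout (fmap t i) (fmap t f) (fmap t inB) (fmap t inC).
Proof.
intros hi hf po.
destruct (cof_pushout_exists (p := S) (i := fmap t i) (fmap t f)
  (approx_cofibrant A) (approx_cofibrant C) (approx_cof ht hi))
  as [Q [jB [jC poQ]]].
destruct (proj2 poQ (t P) (fmap t inB) (fmap t inC)) as [h [[h1 h2] _]].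
{ rewrite <- !fmap_comp; f_equal; apply po. }
rewrite <- h1, <- h2; apply (pushout_iso poQ).
exact (approx_pushout ht hi hf po poQ h1 h2).
Qed.

(** The gluing step behind all constructions with fractions: form the pushout of [e1] and [e2] in
    [M'], map its image to [C] by the universal property, and factor that map by [approx_factor]. *)
Lemma amalgam (E Y1 Y2 : M') (C : M) (e1 : Hom E Y1) (e2 : Hom E Y2)
    (r1 : Hom (t Y1) C) (r2 : Hom (t Y2) C) :
  Cof' e1 -> Cof' e2 -> r1 ∘ fmap t e1 = r2 ∘ fmap t e2 ->
  exists (P : M') (p1 : Hom Y1 P) (p2 : Hom Y2 P) (r : Hom (t P) C),
    Cof' p1 /\ Cof' p2 /\ W r /\ p1 ∘ e1 = p2 ∘ e2 /\
    r ∘ fmap t p1 = r1 /\ r ∘ fmap t p2 = r2.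
Proof.
intros h1 h2 e.
destruct (cof_pushout_exists (p := S') e2 (all_cof E) (all_cof Y2) h1)
  as [Q [q1 [q2 po]]].
pose proof (approx_preserves_pushout h1 h2 po) as pot.
destruct (proj2 pot C r1 r2 e) as [k [[k1 k2] _]].
destruct (approx_factor ht k) as [P [p [r [hp [hr ep]]]]].
exists P, (p ∘ q1), (p ∘ q2), r; repeat split.
- apply (cof_comp S'); [|exact hp].
  exact (cof_pushout (p := S') (all_cof E) (all_cof Y1) h2 (pushout_sym po)).
- apply (cof_comp S'); [|exact hp].
  exact (cof_pushout (p := S') (all_cof E) (all_cof Y2) h1 po).
- exact hr.
- rewrite <- !comp_assoc; f_equal; apply po.
- now rewrite fmap_comp, comp_assoc, <- ep.
- now rewrite fmap_comp, comp_assoc, <- ep.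
Qed.

Definition cospan (X Z Y : M') (C : M) (a : Hom (t X) C) (s : Hom (t Z) C)
    (u : Hom X Y) (w : Hom Z Y) (r : Hom (t Y) C) : Prop :=
  W' w /\ r ∘ fmap t u = a /\ r ∘ fmap t w = s.

(** [phi = w^-1 u] for some cospan [(u, w)] over [C]. *)
Definition is_fraction (X Z : M') (C : M) (a : Hom (t X) C) (s : Hom (t Z) C)
    (phi : @Hom (ho W') X Z) : Prop :=
  exists (Y : M') (u : Hom X Y) (w : Hom Z Y) (r : Hom (t Y) C),
    cospan a s u w r /\ gmap W' w ∘ phi = gmap W' u.

(** Amalgamate [X] and [Z] over the initial object. As [s] is [r] after [fmap t w], two-out-of-three
    makes [fmap t w] a weak equivalence, and [t] reflects these. *)
Lemma cospan_exists (X Z : M') (C : M) (a : Hom (t X) C) (s : Hom (t Z) C) :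
  W s ->
  exists (Y : M') (u : Hom X Y) (w : Hom Z Y) (r : Hom (t Y) C),
    cospan a s u w r /\ Cof' u /\ Cof' w.
Proof.
intro hs; destruct (all_cof X) as [i hi], (all_cof Z) as [j hj].
destruct (amalgam (r1 := a) (r2 := s) hi hj)
  as [Y [u [w [r [hu [hw [hr [_ [e1 e2]]]]]]]]].
{ apply initial_eq, (approx_initial ht). }
exists Y, u, w, r; repeat split; try easy.
apply (approx_weq ht), (weq_cancel_left S hr); now rewrite e2.
Qed.

Lemma cospan_fraction (X Z Y : M') (C : M) (a : Hom (t X) C) (s : Hom (t Z) C)
    (u : Hom X Y) (w : Hom Z Y) (r : Hom (t Y) C) :
  cospan a s u w r ->
  exists phi : @Hom (ho W') X Z, gmap W' w ∘ phi = gmap W' u.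
Proof.
intros [hw _]; destruct (gmap_iso hw) as [v [_ e]].
exists (v ∘ gmap W' u); now rewrite comp_assoc, e, comp_idl.
Qed.

Lemma fraction_exists (X Z : M') (C : M) (a : Hom (t X) C) (s : Hom (t Z) C) :
  W s -> exists phi, is_fraction a s phi.
Proof.
intro hs; destruct (cospan_exists a hs) as [Y [u [w [r [h _]]]]].
destruct (cospan_fraction h) as [phi e].
now exists phi, Y, u, w, r.
Qed.

(** With [fraction_pull], this moves the equation of a fraction along a map [k] of cospans; the
    backward direction cancels the isomorphism [gmap W' k]. *)
Lemma fraction_push (X Z Y Y' : M') (u : Hom X Y) (w : Hom Z Y) (k : Hom Y Y')
    (phi : @Hom (ho W') X Z) :
  gmap W' w ∘ phi = gmap W' u ->
  gmap W' (k ∘ w) ∘ phi = gmap W' (k ∘ u).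
Proof. intro e; now rewrite !gmap_comp, <- comp_assoc, e. Qed.

Lemma fraction_pull (X Z Y Y' : M') (u : Hom X Y) (w : Hom Z Y) (k : Hom Y Y')
    (phi : @Hom (ho W') X Z) : W' k ->
  gmap W' (k ∘ w) ∘ phi = gmap W' (k ∘ u) ->
  gmap W' w ∘ phi = gmap W' u.
Proof.
intros hk e; apply (gmap_monic hk).
now rewrite comp_assoc, <- !gmap_comp.
Qed.

Lemma fraction_unique (X Z : M') (C : M) (a : Hom (t X) C) (s : Hom (t Z) C)
    (phi psi : @Hom (ho W') X Z) : W s ->
  is_fraction a s phi -> is_fraction a s psi -> phi = psi.
Proof.
intros hs [Y1 [u1 [w1 [r1 [[hw1 [a1 s1]] e1]]]]].
intros [Y2 [u2 [w2 [r2 [[hw2 [a2 s2]] e2]]]]].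
destruct (all_cof X) as [i hi], (all_cof Z) as [j hj].
destruct (cof_pushout_exists (p := S') j (all_cof _) (all_cof Z) hi)
  as [E [x [z po]]].
pose proof (approx_preserves_pushout hi hj po) as pot.
(* [amalgam] glues along cofibrations only, so each cospan, seen as a map out of the coproduct [E]
   of [X] and [Z], is replaced by one whose map [E -> V] is a cofibration. *)
assert (cop : forall (Y : M') (u : Hom X Y) (w : Hom Z Y),
  exists (V : M') (e : Hom E V) (q : Hom V Y),
    Cof' e /\ W' q /\ q ∘ (e ∘ x) = u /\ q ∘ (e ∘ z) = w).
{ intros Y u w; destruct (proj2 po Y u w) as [g [[g1 g2] _]].
  { apply initial_eq, zero_initial. }
  destruct (cof_weq_factor (p := S') g (all_cof E)) as [V [e [q [he [hq eg]]]]].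
  exists V, e, q; now rewrite !comp_assoc, <- eg. }
destruct (cop Y1 u1 w1) as [V1 [v1 [q1 [hv1 [hq1 [<- <-]]]]]].
destruct (cop Y2 u2 w2) as [V2 [v2 [q2 [hv2 [hq2 [<- <-]]]]]].
apply (fraction_pull hq1) in e1; apply (fraction_pull hq2) in e2.
rewrite fmap_comp, comp_assoc in a1, a2, s1, s2.
destruct (amalgam (r1 := r1 ∘ fmap t q1) (r2 := r2 ∘ fmap t q2) hv1 hv2)
  as [P [p1 [p2 [r [_ [_ [hr [ep [b1 b2]]]]]]]]].
(* Both maps [t E -> C] restrict to [a] on [t X] and to [s] on [t Z], and [t E] is again a
   pushout. *)
{ apply (pushout_epic pot); rewrite <- !(comp_assoc (_ ∘ _)), <- !fmap_comp.
  - now rewrite a1, a2.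
  - now rewrite s1, s2. }
apply (@fraction_push _ _ _ _ _ _ p1) in e1.
apply (@fraction_push _ _ _ _ _ _ p2) in e2.
(* In [P] the two cospans coincide; their common right leg is a weak equivalence and can be
   cancelled. *)
assert (hw : W' (p1 ∘ (v1 ∘ z))).
{ apply (approx_weq ht), (weq_cancel_left S hr).
  now rewrite fmap_comp, comp_assoc, b1, s1. }
apply (gmap_monic hw).
now rewrite e1, !comp_assoc, ep, <- !comp_assoc, e2.
Qed.

Lemma fraction_id (X : M') (C : M) (s : Hom (t X) C) :
  is_fraction s s (idm (c := ho W') X).
Proof.
exists X, (idm X), (idm X), s; split; [split; [|split]|].
- apply (iso_weq S'), iso_id.
- now rewrite fmap_id, comp_idr.
- now rewrite fmap_id, comp_idr.
- apply comp_idr.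
Qed.

Lemma fraction_gamma (X Z : M') (f : Hom X Z) :
  is_fraction (fmap t f) (idm (t Z)) (gmap W' f).
Proof.
exists Z, f, (idm Z), (idm (t Z)); split; [split; [|split]|].
- apply (iso_weq S'), iso_id.
- apply comp_idl.
- now rewrite fmap_id, comp_idl.
- exact (comp_idl (c := ho W') (gmap W' f)).
Qed.

(** Glue the two cospans along [Z] over [D]: on [t Z], both [g ∘ r1] and [r2] restrict to [g ∘ s].
    The outer legs form a cospan for the composite. *)
Lemma fraction_comp (X Z V : M') (C D : M) (g : Hom C D) (a : Hom (t X) C)
    (s : Hom (t Z) C) (s' : Hom (t V) D) phi psi :
  W s -> W s' ->
  is_fraction a s phi -> is_fraction (g ∘ s) s' psi ->
  is_fraction (g ∘ a) s' (psi ∘ phi).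
Proof.
intros hs hs' fphi fpsi.
destruct (cospan_exists a hs) as [Y1 [u1 [w1 [r1 [c1 [hu1 hw1]]]]]].
destruct (cospan_exists (g ∘ s) hs') as [Y2 [u2 [w2 [r2 [c2 [hu2 hw2]]]]]].
destruct (cospan_fraction c1) as [phi' e1], (cospan_fraction c2) as [psi' e2].
(* By uniqueness, [phi] and [psi] may be computed from cospans whose legs are cofibrations, as the
   gluing requires. *)
rewrite (fraction_unique (psi := phi') hs fphi) by now exists Y1, u1, w1, r1.
rewrite (fraction_unique (psi := psi') hs' fpsi) by now exists Y2, u2, w2, r2.
destruct c1 as [hw1' [a1 s1]], c2 as [hw2' [a2 s2]].
destruct (amalgam (r1 := g ∘ r1) (r2 := r2) hw1 hu2)
  as [P [p1 [p2 [r [_ [_ [hr [ep [b1 b2]]]]]]]]].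
{ now rewrite <- comp_assoc, s1. }
exists P, (p1 ∘ u1), (p2 ∘ w2), r; split; [split; [|split]|].
- apply (approx_weq ht), (weq_cancel_left S hr).
  now rewrite fmap_comp, comp_assoc, b2, s2.
- now rewrite fmap_comp, comp_assoc, b1, <- comp_assoc, a1.
- now rewrite fmap_comp, comp_assoc, b2, s2.
- rewrite comp_assoc, (fraction_push p2 e2), <- ep.
  exact (fraction_push p1 e1).
Qed.

(** Two-out-of-three puts [r], then [u], among the weak equivalences, so both legs of the cospan
    become invertible. *)
Lemma fraction_iso (X Z : M') (C : M) (a : Hom (t X) C) (s : Hom (t Z) C) phi :
  W a -> W s -> is_fraction a s phi -> is_iso phi.
Proof.
intros ha hs [Y [u [w [r [[hw [a1 s1]] e]]]]].
apply (iso_cancel_left (C := ho W') (gmap_iso hw)); rewrite e; apply gmap_iso.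
assert (hr : W r).
{ apply (weq_cancel_right S (f := fmap t w)).
  - now apply (approx_weq ht).
  - now rewrite s1. }
apply (approx_weq ht), (weq_cancel_left S hr); now rewrite a1.
Qed.

(** * The quasi-inverse *)

(** Apply [approx_factor] to the map from the initial object [t (zero S')] to [B]. Packing the
    object with its map lets one choice give both [res] and [res_map]. *)
Lemma resolution_exists (B : M) :
  exists c : {X : M' & Hom (t X) B}, W (projT2 c).
Proof.
destruct (approx_initial ht B) as [f _].
destruct (approx_factor ht f) as [X [_ [r [_ [hr _]]]]].
now exists (existT _ X r).
Qed.

Definition res (B : M) : M' :=
  projT1 (proj1_sig (constructive_indefinite_description _ (resolution_exists B))).

Definition res_map (B : M) : Hom (t (res B)) B :=
  projT2 (proj1_sig (constructive_indefinite_description _ (resolution_exists B))).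

Lemma res_map_weq (B : M) : W (res_map B).
Proof.
exact (proj2_sig (constructive_indefinite_description _ (resolution_exists B))).
Qed.

Definition fraction (X Z : M') (C : M) (a : Hom (t X) C) (s : Hom (t Z) C)
    (hs : W s) : @Hom (ho W') X Z :=
  proj1_sig (constructive_indefinite_description _ (fraction_exists a hs)).

Lemma fractionP (X Z : M') (C : M) (a : Hom (t X) C) (s : Hom (t Z) C)
    (hs : W s) : is_fraction a s (fraction a hs).
Proof.
exact (proj2_sig (constructive_indefinite_description _ (fraction_exists a hs))).
Qed.

Lemma res_fraction_id (B : M) :
  fraction (idm B ∘ res_map B) (res_map_weq B) = idm (c := ho W') (res B).
Proof.
apply (fraction_unique (res_map_weq B) (fractionP _ _)).
rewrite comp_idl; apply fraction_id.
Qed.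

Lemma res_fraction_comp (A B C : M) (g : Hom B C) (f : Hom A B) :
  fraction (g ∘ f ∘ res_map A) (res_map_weq C) =
  fraction (g ∘ res_map B) (res_map_weq C) ∘
    fraction (f ∘ res_map A) (res_map_weq B).
Proof.
apply (fraction_unique (res_map_weq C) (fractionP _ _)).
rewrite <- comp_assoc.
exact (fraction_comp (res_map_weq B) (res_map_weq C) (fractionP _ _) (fractionP _ _)).
Qed.

Definition res_functor : functor M (ho W') :=
  @Functor M (ho W') res
    (fun A B f => fraction (f ∘ res_map A) (res_map_weq B))
    res_fraction_id res_fraction_comp.

Lemma res_functor_inverts : inverts W res_functor.
Proof.
intros A B f hf; refine (fraction_iso _ (res_map_weq B) (fractionP _ _)).
exact (weq_comp S (res_map_weq A) hf).
Qed.

Let T : functor (ho W') (ho W) := ho_functor (cofibrant_approximation_weq ht).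
Let G : functor (ho W) (ho W') := ho_lift res_functor_inverts.

(** The component at [A] is the fraction of [res_map (t A)] by the identity of [t A]. *)
Lemma approx_unit : nat_isomorphic (comp_functor G T) (id_functor (ho W')).
Proof.
assert (hid : forall A : M', W (idm (t A))).
{ intro A; apply (iso_weq S), iso_id. }
exists (fun A : M' => fraction (res_map (t A)) (hid A)); split.
{ intro A; exact (fraction_iso (res_map_weq (t A)) (hid A) (fractionP _ _)). }
apply (@ho_natural M' W' (ho W') (comp_functor G T) (id_functor (ho W'))).
intros A B f; simpl comp_functor; simpl id_functor.
change (fraction (res_map (t B)) (hid B) ∘
    fmap G (fmap T (gmap W' f)) =
  gmap W' f ∘ fraction (res_map (t A)) (hid A)).
assert (e : fmap G (fmap T (gmap W' f)) =
  fraction (fmap t f ∘ res_map (t A)) (res_map_weq (t B))).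
{ refine (eq_trans (f_equal (fmap G) (gmap_lift _ f)) _).
  exact (gmap_lift res_functor_inverts (fmap t f)). }
rewrite e.
(* Both sides of the naturality square are fractions of [fmap t f ∘ res_map (t A)] by the identity
   of [t B]; [fraction_comp] is used with [g] the identity on the left and [fmap t f] on the
   right. *)
apply (@fraction_unique _ _ _ (fmap t f ∘ res_map (t A)) (idm (t B))).
- apply hid.
- rewrite <- (comp_idl (fmap t f ∘ res_map (t A))).
  refine (fraction_comp (s := res_map (t B)) (res_map_weq _) (hid B) _ _).
  + rewrite comp_idl; apply fractionP.
  + rewrite comp_idl; apply fractionP.
- refine (fraction_comp (hid A) (hid B) (fractionP _ _) _).
  rewrite comp_idr; apply fraction_gamma.
Qed.

Lemma approx_counit : nat_isomorphic (comp_functor T G) (id_functor (ho W)).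
Proof.
exists (fun A : M => gmap W (res_map A)); split.
{ intro A; exact (gmap_iso (res_map_weq A)). }
apply (@ho_natural M W (ho W) (comp_functor T G) (id_functor (ho W))).
intros A B f.
change (gmap W (res_map B) ∘ fmap T (fmap G (gmap W f)) =
  gmap W f ∘ gmap W (res_map A)).
assert (e : fmap G (gmap W f) =
  fraction (f ∘ res_map A) (res_map_weq B)).
{ exact (gmap_lift res_functor_inverts f). }
rewrite e; pose proof (fractionP (f ∘ res_map A) (res_map_weq B)) as hphi.
revert hphi; clear e; generalize (fraction (f ∘ res_map A) (res_map_weq B)).
intros phi [Y [u [w [r [[_ [a1 s1]] e]]]]].
(* Both sides now start from a factor [gmap W r]; what remains is the image under [T] of the
   equation that defines [phi]. *)
rewrite <- s1, <- gmap_comp, <- a1, !gmap_comp, <- comp_assoc; f_equal.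
apply (f_equal (fmap T)) in e.
refine (eq_trans _ (eq_trans e (gmap_lift _ u))).
refine (eq_trans _ (eq_sym (fmap_comp T _ _))).
exact (f_equal (fun k => k ∘ _) (eq_sym (gmap_lift _ w))).
Qed.

Lemma cofibrant_approximation_equivalence : is_equivalence T.
Proof. exists G; split; [apply approx_unit|apply approx_counit]. Qed.

End Approximation.

(** * Duality *)

(** [op (op C)] and [C] differ only in their proof fields, but are not
    convertible. *)
Definition to_op_op (C : category) : functor C (op (op C)) :=
  @Functor C (op (op C)) (fun A => A) (fun _ _ f => f)
    (fun _ => eq_refl) (fun _ _ _ _ _ => eq_refl).

Section HoOp.

Variables (M : category) (W : mor_class M).

Definition gamma_op : functor M (op (ho (op_class W))) :=
  comp_functor (op_functor (gamma (op_class W))) (to_op_op M).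

Lemma gamma_op_inverts : inverts W gamma_op.
Proof.
intros A B w hw; apply is_iso_op.
exact (@gmap_iso (op M) (op_class W) B A w hw).
Qed.

Lemma op_gamma_inverts : inverts (op_class W) (op_functor (gamma W)).
Proof. intros A B w hw; apply is_iso_op; exact (@gmap_iso M W B A w hw). Qed.

Definition ho_to_op : functor (ho W) (op (ho (op_class W))) :=
  ho_lift gamma_op_inverts.

Definition ho_of_op : functor (ho (op_class W)) (op (ho W)) :=
  ho_lift op_gamma_inverts.

(** The composite agrees with the identity on maps of [M]. Stating this as naturality of identity
    components lets [ho_natural] extend it to all maps without an equality of functors. *)
Lemma ho_to_opK (A B : ho W) (c : Hom A B) :
  fmap ho_of_op (fmap ho_to_op c) = c.
Proof.
assert (e := @ho_natural M W (op (op (ho W)))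
  (comp_functor (op_functor ho_of_op) ho_to_op) (to_op_op (ho W))
  (fun A => idm (c := ho W) A)).
specialize (fun h => e h A B c).
refine
  (eq_trans (eq_sym (comp_idl (c := op (op (ho W))) _))
  (eq_trans (e _) (comp_idr _))).
clear; intros A B f.
refine (eq_trans (comp_idl _) (eq_trans _ (eq_sym (comp_idr _)))).
refine (eq_trans (f_equal (fmap ho_of_op) (gmap_lift gamma_op_inverts f)) _).
exact (@gmap_lift (op M) (op_class W) _ _ op_gamma_inverts B A f).
Qed.

Lemma ho_of_opK (A B : ho (op_class W)) (c : Hom A B) :
  fmap ho_to_op (fmap ho_of_op c) = c.
Proof.
assert (e := @ho_natural (op M) (op_class W) (op (op (ho (op_class W))))
  (comp_functor (op_functor ho_to_op) ho_of_op) (to_op_op (ho (op_class W)))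
  (fun A => idm (c := ho (op_class W)) A)).
specialize (fun h => e h A B c).
refine
  (eq_trans (eq_sym (comp_idl (c := op (op (ho (op_class W)))) _))
  (eq_trans (e _) (comp_idr _))).
clear; intros A B f.
refine (eq_trans (comp_idl _) (eq_trans _ (eq_sym (comp_idr _)))).
refine (eq_trans (f_equal (fmap ho_to_op)
  (@gmap_lift (op M) (op_class W) _ _ op_gamma_inverts A B f)) _).
exact (@gmap_lift M W _ _ gamma_op_inverts B A f).
Qed.

End HoOp.

(** As for [ho_to_opK], the two functors are compared on maps of [M'] through [ho_natural] with
    identity components. *)
Lemma ho_to_op_functor (M' M : category) (W' : mor_class M') (W : mor_class M)
    (t : functor M' M) (ht : preserves W' W t)
    (hop : preserves (op_class W') (op_class W) (op_functor t))
    (A B : ho W') (c : Hom A B) :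
  fmap (ho_to_op W) (fmap (ho_functor ht) c) =
  fmap (ho_functor hop) (fmap (ho_to_op W') c).
Proof.
assert (e := @ho_natural M' W' (op (ho (op_class W)))
  (comp_functor (ho_to_op W) (ho_functor ht))
  (comp_functor (op_functor (ho_functor hop)) (ho_to_op W'))
  (fun A => idm (c := ho (op_class W)) (t A))).
specialize (fun h => e h A B c).
refine
  (eq_trans (eq_sym (comp_idl (c := op (ho (op_class W))) _))
  (eq_trans (e _) (comp_idr _))).
clear; intros A B f.
refine (eq_trans (comp_idl _) (eq_trans _ (eq_sym (comp_idr _)))).
refine (eq_trans (f_equal (fmap (ho_to_op W)) (gmap_lift _ f)) _).
refine (eq_trans (gmap_lift (gamma_op_inverts (W := W)) (fmap t f)) (eq_sym _)).
refine (eq_trans (f_equal (fmap (ho_functor hop))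
  (gmap_lift (gamma_op_inverts (W := W')) f)) _).
exact (@gmap_lift (op M') (op_class W') _ _ (gamma_comp_inverts hop) B A f).
Qed.

(** The quasi-inverse [G] and both natural isomorphisms are transported along the mutually inverse
    [ho_to_op] and [ho_of_op]. *)
Lemma ho_functor_equivalence_op (M' M : category) (W' : mor_class M')
    (W : mor_class M) (t : functor M' M) (ht : preserves W' W t)
    (hop : preserves (op_class W') (op_class W) (op_functor t)) :
  is_equivalence (ho_functor hop) -> is_equivalence (ho_functor ht).
Proof.
intros [G [[eta [ieta neta]] [eps [ieps neps]]]].
pose (H := comp_functor (op_functor (comp_functor (ho_of_op W') G)) (ho_to_op W)).
pose (J' := fun A B (k : @Hom (ho (op_class W')) A B) =>
  fmap (ho_of_op W') k : @Hom (ho W') B A).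
pose (J := fun A B (k : @Hom (ho (op_class W)) A B) =>
  fmap (ho_of_op W) k : @Hom (ho W) B A).
(* [H] lands in [op (op (ho W'))], so it is rebuilt field by field with target [ho W']. *)
exists (@Functor (ho W) (ho W') H (@fmap _ _ H) (fmap_id H)
  (fun _ _ _ g f => fmap_comp H g f)).
(* Passing to opposites reverses [eta] and [eps], which now start at the identity functors. *)
split; apply nat_isomorphic_sym.
- exists (fun A => J' _ _ (eta A)); split.
  { intro A; exact (is_iso_op (fmap_iso (ho_of_op W') (ieta A))). }
  intros A B c.
  pose proof (f_equal (@fmap _ _ (ho_of_op W') _ _) (neta _ _ (fmap (ho_to_op W') c))) as e.
  rewrite !(fmap_comp (ho_of_op W')) in e.
  refine (eq_trans (f_equal (comp (c := ho W') (J' _ _ (eta B)))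
    (eq_sym (ho_to_opK c))) _).
  refine (eq_trans (eq_sym e) _).
  exact (f_equal (fun k => comp (c := ho W') (J' _ _ (fmap G k)) (J' _ _ (eta A)))
    (eq_sym (ho_to_op_functor ht hop c))).
- exists (fun A => J _ _ (eps A)); split.
  { intro A; exact (is_iso_op (fmap_iso (ho_of_op W) (ieps A))). }
  intros A B c.
  pose proof (f_equal (@fmap _ _ (ho_of_op W) _ _) (neps _ _ (fmap (ho_to_op W) c))) as e.
  rewrite !(fmap_comp (ho_of_op W)) in e.
  refine (eq_trans (f_equal (comp (c := ho W) (J _ _ (eps B)))
    (eq_sym (ho_to_opK c))) _).
  refine (eq_trans (eq_sym e) _).
  refine (f_equal (fun k => comp (c := ho W) k (J _ _ (eps A))) _).
  (* Inserting [ho_of_op] after [ho_to_op] allows [ho_functor ht] to be exchanged for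
     [ho_functor hop]. *)
  refine (eq_trans _ (ho_to_opK _)).
  refine (f_equal (J _ _) (eq_trans _ (eq_sym (ho_to_op_functor ht hop _)))).
  exact (f_equal (fmap (ho_functor hop)) (eq_sym (ho_of_opK _))).
Qed.

Theorem theorem6p1p7 :
  (forall (M' M : category) (W' Cof' : mor_class M') (W Cof : mor_class M)
      (S' : precofibration W' Cof') (S : precofibration W Cof)
      (t : functor M' M) (ht : cofibrant_approximation S' S t),
    is_equivalence (ho_functor (cofibrant_approximation_weq ht)))
  /\
  (forall (M' M : category) (W' Fib' : mor_class M') (W Fib : mor_class M)
      (S' : prefibration W' Fib') (S : prefibration W Fib)
      (t : functor M' M) (ht : fibrant_approximation S' S t),
    is_equivalence (ho_functor (fibrant_approximation_weq ht))).
Proof.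
split.
- intros; apply cofibrant_approximation_equivalence.
- intros; exact (ho_functor_equivalence_op _
    (cofibrant_approximation_equivalence ht)).
Qed.
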